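(* For every $a\in\mathbb{R}$ and $\alpha\ge0$, the map $\mathcal{E}_{a,\alpha}$ is an admissible extension $BL_+(\mathbb{R})\to\mathrm{Hom}(\mathbb{H})$. Moreover, for every $a\in\mathbb{R}$, $\alpha>0$ and $f\in BL_+(\mathbb{R})$, the map $F=\mathcal{E}_{a,\alpha}f$ is a quasiconformal map of $\mathbb{H}$.
   Context: $\mathbb{H}=\{z=x+iy: x\in\mathbb{R},\ y>0\}$. $\mathrm{Hom}(\mathbb{H})$ is the class of homeomorphisms of $\mathbb{H}$ onto itself. $\mathrm{Id}$ is the identity function. A homeomorphism $F:\mathbb{H}\to\mathbb{H}$ is quasiconformal if $F\in W^{1,2}_{loc}(\mathbb{H})$ and $\sup_{z\in\mathbb{H}}\frac{|\partial_{\bar z}F(z)|}{|\partial_zF(z)|}<1$. $BL_+(\mathbb{R})$ is the set of $f\in C^1(\mathbb{R})$, $f:\mathbb{R}\to\mathbb{R}$, for which there are $b,B>0$ with $b\le f'(x)\le B$ for all $x\in\mathbb{R}$. For $f_n,f\in BL_+(\mathbb{R})$ write $f_n\xrightarrow{BL_+(\mathbb{R})}f$ if $f_n\to f$ and $f_n'\to f'$ uniformly on compact sets of $\mathbb{R}$ and there are $b,B>0$ such that $b\le f_n'(x)\le B$ for all $n\ge1$ and $x\in\mathbb{R}$. A map $E:BL_+(\mathbb{R})\to\mathrm{Hom}(\mathbb{H})$ is an admissible extension if: (P1) for every $f\in BL_+(\mathbb{R})$, $\lim_{y\to0^+}Ef(x+iy)=f(x)$ uniformly for $x$ in compact sets of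 $\mathbb{R}$; (P2) $E(a\,\mathrm{Id}+b)(z)=az+b$ for every $a>0$, $b\in\mathbb{R}$; (P3) $E(f\circ g)=Ef\circ Eg$ for all $f,g\in BL_+(\mathbb{R})$; (P4) if $f_n\xrightarrow{BL_+(\mathbb{R})}f$ then $Ef_n(z)\to Ef(z)$ for all $z\in\mathbb{H}$. For $a\in\mathbb{R}$, $\alpha>0$ and $z=x+iy\in\mathbb{H}$, $$\mathcal{E}_{a,\alpha}f(z)=(1-\tfrac a\alpha)f(x+ay)+\tfrac a\alpha f(x-(\alpha-a)y)+\tfrac i\alpha f(x+ay)-\tfrac i\alpha f(x-(\alpha-a)y),$$ and for $\alpha=0$, $$\mathcal{E}_{a,0}f(z)=f(x+ay)-ay f'(x+ay)+iyf'(x+ay).$$ *)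

(* Defs.v *)
From HB Require Import structures.
From mathcomp Require Import all_boot all_order all_algebra.
From mathcomp Require Import all_classical all_reals all_analysis.
From mathcomp Require Import ess_sup_inf complex.

Set Implicit Arguments.
Unset Strict Implicit.
Unset Printing Implicit Defensive.

Import Order.TTheory GRing.Theory Num.Theory.
Import numFieldNormedType.Exports.

Local Open Scope ring_scope.
Local Open Scope classical_set_scope.

(* The complex plane is represented by [R * R], which carries the topology and
   the product sigma-algebra; the pair (x, y) stands for x + iy. A self-map of
   the half-plane is a total map of the plane of which only the values on
   [halfplane R] are relevant. *)
Definition halfplane (R : realType) : set (R * R) := [set z | 0 < z.2].
Arguments halfplane : clear implicits.

Definition homeo_onto_self (T : topologicalType) (A : set T) (F : T -> T) : Prop :=
  {within A, continuous F} /\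
  exists G : T -> T,
    [/\ {within A, continuous G},
        (forall z, A z -> A (F z)), (forall z, A z -> A (G z)),
        (forall z, A z -> G (F z) = z) & (forall z, A z -> F (G z) = z)].

Section BiLipschitz.
Variable R : realType.
Implicit Types f : R -> R.

Definition deriv_between (b B : R) f : Prop :=
  forall x, b <= f^`() x <= B.

Definition BLplus f : Prop :=
  [/\ (forall x, derivable f x 1), continuous f^`() &
      exists b B : R, [/\ 0 < b, 0 < B & deriv_between b B f]].

(* [{family compact, _ --> _}] is uniform convergence on compact sets. *)
Definition BLplus_cvg (f_ : nat -> R -> R) f : Prop :=
  [/\ (forall n, BLplus (f_ n)), BLplus f,
      {family compact, f_ @ \oo --> f},
      {family compact, (fun n => (f_ n)^`()) @ \oo --> f^`()} &
      exists b B : R,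
        [/\ 0 < b, 0 < B & forall n, deriv_between b B (f_ n)]].

Record admissible_extension (E : (R -> R) -> R * R -> R * R) : Prop := {
  ext_homeo : forall f, BLplus f -> homeo_onto_self (halfplane R) (E f);
  ext_boundary : forall f, BLplus f ->
    {family compact, (fun y x : R => E f (x, y)) @ 0^'+ -->
                     (fun x : R => (f x, 0 : R))};
  ext_affine : forall a b : R, 0 < a -> forall z, halfplane R z ->
    E (fun x => a * x + b) z = (a * z.1 + b, a * z.2);
  ext_comp : forall f g, BLplus f -> BLplus g -> forall z, halfplane R z ->
    E (f \o g) z = E f (E g z);
  ext_cvg : forall (f_ : nat -> R -> R) f, BLplus_cvg f_ f ->
    forall z, halfplane R z -> E (f_ n) z @[n --> \oo] --> E f z }.

Definition calE (a alpha : R) f (z : R * R) : R * R :=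
  let x := z.1 in let y := z.2 in let f' := f^`() in
  if alpha == 0 then
    (f (x + a * y) - a * y * f' (x + a * y), y * f' (x + a * y))
  else
    ((1 - a / alpha) * f (x + a * y) + a / alpha * f (x - (alpha - a) * y),
     1 / alpha * f (x + a * y) - 1 / alpha * f (x - (alpha - a) * y)).

End BiLipschitz.

Section Quasiconformal.
Variable R : realType.
Local Open Scope complex_scope.

Definition leb2 := (@lebesgue_measure R \x @lebesgue_measure R)%E.

(* C^oo: all iterated directional derivatives exist and are continuous. *)
Definition smooth (phi : R * R -> R) : Prop :=
  forall s : seq (R * R),
    let g := foldr (fun v h z => 'D_v h z) phi s in
    continuous g /\ forall z v, derivable g z v.

Definition test_function (Omega : set (R * R)) (phi : R * R -> R) : Prop :=
  let supp := closure [set z | phi z != 0] in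
  [/\ smooth phi, compact supp & supp `<=` Omega].

Definition L2loc (Omega : set (R * R)) (u : R * R -> R) : Prop :=
  measurable_fun Omega (u : measurableTypeR R * measurableTypeR R -> R) /\
  forall K, compact K -> K `<=` Omega ->
    (\int[leb2]_(z in K) ((u z) ^+ 2)%:E < +oo)%E.

(* [v] is the distributional derivative of [u] on [Omega] in direction [e]. *)
Definition weak_derivative (Omega : set (R * R)) (e : R * R)
    (u v : R * R -> R) : Prop :=
  forall phi, test_function Omega phi ->
    \int[leb2]_(z in Omega) (u z * 'D_e phi z) =
    - \int[leb2]_(z in Omega) (v z * phi z).

(* [u] belongs to W^{1,2}_loc(Omega), with weak gradient [(ux, uy)]. *)
Definition W12loc_grad (Omega : set (R * R)) (u ux uy : R * R -> R) : Prop :=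
  [/\ L2loc Omega u, L2loc Omega ux, L2loc Omega uy,
      weak_derivative Omega (1, 0) u ux & weak_derivative Omega (0, 1) u uy].

(* Wirtinger derivatives in terms of the partial derivatives Fx and Fy. *)
Definition dz (Fx Fy : R[i]) : R[i] := (Fx - ('i)%C * Fy) / 2%:R.
Definition dzbar (Fx Fy : R[i]) : R[i] := (Fx + ('i)%C * Fy) / 2%:R.

Definition cabs (w : R[i]) : R := ComplexField.Normc.normc w.

(* Weak derivatives being defined almost everywhere, the supremum of
   |dzbar F| / |dz F| over the half-plane is the essential one, and dz F must
   be nonzero almost everywhere for the quotient to make sense. The quotient
   is extended by 0 outside the half-plane, which does not affect the
   essential supremum since the quotient is nonnegative. *)
Definition quasiconformal (F : R * R -> R * R) : Prop :=
  homeo_onto_self (halfplane R) F /\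
  exists ux uy vx vy : R * R -> R,
    let Fx z := ux z +i* vx z in
    let Fy z := uy z +i* vy z in
    let ratio z := cabs (dzbar (Fx z) (Fy z)) / cabs (dz (Fx z) (Fy z)) in
    [/\ W12loc_grad (halfplane R) (fun z => (F z).1) ux uy,
        W12loc_grad (halfplane R) (fun z => (F z).2) vx vy,
        (\forall z \ae leb2, halfplane R z -> dz (Fx z) (Fy z) != 0) &
        (ess_sup leb2 ((fun z => (ratio z)%:E) \_ (halfplane R)) < 1)%E].

End Quasiconformal.

(* Main.v *)
Require Import Defs.
From mathcomp Require Import all_boot all_order all_algebra.
From mathcomp Require Import all_classical all_reals all_analysis.
From mathcomp Require Import measurable_realfun ess_sup_inf complex ring lra.

(* Conjugating by the linear map z |-> (x + a y, x - (alpha - a) y) turns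
   calE a alpha f into f x f, and for alpha = 0 conjugating by
   z |-> (x + a y, y) turns it into the tangent map (u, y) |-> (f u, y f'(u)).
   Functoriality of these two constructions gives (P3), and then the inverse of
   calE a alpha f is calE a alpha of the inverse of f.

   For alpha > 0 the map F = calE a alpha f is C^1 on the whole plane, so its
   weak derivatives are the classical ones: by Fubini and the fundamental
   theorem of calculus, the integral of a directional derivative of a C^1
   function with compact support vanishes. Moreover
   |dz F|^2 - |dzbar F|^2 = det DF = f'(x + a y) f'(x - (alpha - a) y) >= b^2
   while dzbar F is bounded, so that |dzbar F| / |dz F| stays away from 1. *)

Set Implicit Arguments.
Unset Strict Implicit.
Unset Printing Implicit Defensive.

Import Order.TTheory GRing.Theory Num.Theory.
Import numFieldNormedType.Exports.

Local Open Scope ring_scope.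

(** * [BLplus] as a group under composition *)

Section BiLipschitz.
Local Open Scope classical_set_scope.
Context {R : realType}.
Implicit Types (f g : R -> R) (a alpha b B x y : R) (z : R * R).

Lemma BLplus_is_derive f x : BLplus f -> is_derive x 1 f (f^`() x).
Proof. by move=> [df _ _]; rewrite derive1E; apply/derivableP/df. Qed.

Lemma BLplus_continuous f : BLplus f -> continuous f.
Proof.
by move=> [df _ _] x; apply: differentiable_continuous; exact/derivable1_diffP.
Qed.

(** Mean value theorem. The lower bound will give strict monotonicity and surjectivity, the upper
    one the Lipschitz estimate. *)
Lemma deriv_between_increment f b B x y : BLplus f -> deriv_between b B f ->
  x <= y -> b * (y - x) <= f y - f x <= B * (y - x).
Proof.
move=> Bf fbB xy.
have [c _ ->] : exists2 c, c \in `[x, y]%R & f y - f x = derive1 f c * (y - x).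
  apply: MVT_segment => // [c _|]; first exact: BLplus_is_derive.
  exact/continuous_subspaceT/BLplus_continuous.
by have /andP[? ?] := fbB c; rewrite !ler_wpM2r// subr_ge0.
Qed.

Lemma deriv_between_lipschitz f b B x y : BLplus f -> 0 < b ->
  deriv_between b B f -> `|f x - f y| <= B * `|x - y|.
Proof.
move=> Bf b0 fbB; wlog xy : x y / y <= x => [wlg|].
  have [/wlg//|/ltW /wlg] := leP y x.
  by rewrite (distrC (f y)) (distrC y).
have /andP[h1 h2] := deriv_between_increment Bf fbB xy.
rewrite !ger0_norm ?subr_ge0//.
by rewrite -subr_ge0 (le_trans _ h1)// mulr_ge0 ?subr_ge0// ltW.
Qed.

Lemma BLplus_increasing f : BLplus f -> {mono f : x y / x < y}.
Proof.
move=> Bf; have [_ _ [b [B [b0 _ fbB]]]] := Bf; apply: leW_mono; apply: le_mono.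
move=> x y xy; have /andP[+ _] := deriv_between_increment Bf fbB (ltW xy).
by move=> /(lt_le_trans _) h; rewrite -subr_gt0 h// mulr_gt0// subr_gt0.
Qed.

Lemma BLplus_comp f g : BLplus f -> BLplus g -> BLplus (f \o g).
Proof.
move=> Bf Bg; have [df cf' [b [B [b0 B0 fbB]]]] := Bf.
have [dg cg' [c [C [c0 C0 gcC]]]] := Bg.
have fgE : (f \o g)^`() = (fun x => derive1 f (g x) * derive1 g x).
  by apply/funext => x; rewrite derive1_comp.
split; last 1 first.
- exists (b * c), (B * C); split; [exact: mulr_gt0..|move=> x; rewrite fgE].
  have /andP[? ?] := fbB (g x); have /andP[? ?] := gcC x.
  have fx0 : 0 <= derive1 f (g x) by apply: le_trans (ltW b0) _.
  have gx0 : 0 <= derive1 g x by apply: le_trans (ltW c0) _.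
  by rewrite !ler_pM// ltW.
- move=> x; apply/derivable1_diffP; apply: differentiable_comp;
    exact/derivable1_diffP.
- rewrite fgE => x; apply: cvgM; last exact: cg'.
  apply: (@continuous_comp _ _ _ g); last exact: cf'.
  exact: BLplus_continuous.
Qed.

(** Since [f] grows at rate at least [b], it has covered the distance [|y - f 0|] once its argument
    has moved by [M = |y - f 0| / b]; the intermediate value theorem on [[-M, M]] concludes. *)
Lemma BLplus_surjective f y : BLplus f -> exists x, f x = y.
Proof.
move=> Bf; have [_ _ [b [B [b0 _ fbB]]]] := Bf.
pose M := `|y - f 0| / b.
have M0 : 0 <= M by rewrite divr_ge0// ltW.
have MN : - M <= M by rewrite (le_trans _ M0)// oppr_le0.
have /andP[h1 _] := deriv_between_increment Bf fbB M0.
have /andP[h2 _] : b * (0 - - M) <= f 0 - f (- M) <= B * (0 - - M).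
  by apply: deriv_between_increment; rewrite ?oppr_le0.
have bM : b * M = `|y - f 0| by rewrite mulrC divfK// gt_eqF.
have yn : y - f 0 <= `|y - f 0| by exact: ler_norm.
have yn' : - (y - f 0) <= `|y - f 0| by rewrite -normrN ler_norm.
have fy : f (- M) <= y <= f M.
  by move: h1 h2; rewrite sub0r opprK subr0 bM => ? ?; apply/andP; split; lra.
have [||x _ <-] := @IVT R f (- M) M y MN; last by exists x.
- exact/continuous_subspaceT/BLplus_continuous.
- by case/andP: fy => ? ?; rewrite ge_min le_max; apply/andP; split;
    apply/orP; [left|right].
Qed.

(** The inverse has derivative [1 / f'(g y)], which is continuous and lies in [[1/B, 1/b]]. *)
Lemma BLplus_inverse f : BLplus f ->
  exists g, [/\ BLplus g, cancel f g & cancel g f].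
Proof.
move=> Bf; have [df cf' [b [B [b0 B0 fbB]]]] := Bf.
have /choice[g gK] y : exists x, f x = y by exact: BLplus_surjective.
have f_mono : {mono f : x y / x < y} := BLplus_increasing Bf.
have fI : injective f.
  by move=> x y fxy; case: (ltgtP x y) => // /=; rewrite -f_mono fxy ltxx.
have fK : cancel f g by move=> x; apply: fI; rewrite gK.
have f'0 x : derive1 f x != 0.
  by have /andP[/(lt_le_trans b0) h _] := fbB x; rewrite gt_eqF.
have dg y : is_derive y 1 g (derive1 f (g y))^-1.
  rewrite -{1}(gK y); apply: is_derive_inverse => //.
  - by apply: (@filterE _ (nbhs (g y))); exact: fK.
  - by apply: (@filterE _ (nbhs (g y))); exact: BLplus_continuous.
  - exact: BLplus_is_derive.
have gE : derive1 g = fun y => (derive1 f (g y))^-1.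
  by apply/funext => y; rewrite derive1E; apply: derive_val.
have cg : continuous g.
  move=> x; apply: differentiable_continuous; apply/derivable1_diffP.
  by have [] := dg x.
have cf'g : continuous (derive1 f \o g).
  by move=> x; apply: continuous_comp; [exact: cg|exact: cf'].
exists g; split; [split|exact: fK|exact: gK].
- by move=> y; have [] := dg y.
- rewrite gE => y; exact: cvgV (f'0 _) (cf'g y).
- exists B^-1, b^-1; rewrite !invr_gt0; split => // y; rewrite gE.
  have /andP[h1 h2] := fbB (g y).
  have h0 := lt_le_trans b0 h1.
  by apply/andP; split; rewrite lef_pV2 ?posrE.
Qed.

(** * Functoriality, the homeomorphism property and pointwise continuity of [calE] *)

Lemma calE_comp a alpha f g z : BLplus f -> BLplus g ->
  calE a alpha (f \o g) z = calE a alpha f (calE a alpha g z).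
Proof.
move=> [df _ _] [dg _ _]; rewrite /calE.
case: eqP => [_|/eqP a0] /=.
  (* The coordinate [x + a y] of the image point is [g (x + a y)]; what remains is the chain
     rule. *)
  have e0 (t : R) : t - a * z.2 * derive1 g (z.1 + a * z.2) +
     a * (z.2 * derive1 g (z.1 + a * z.2)) = t by ring.
  by rewrite e0 derive1_comp//; congr pair; ring.
set u := z.1 + _; set v := z.1 - _.
(* The two linear coordinates of the image point are [g u] and [g v], so the outer map evaluates [f]
   exactly there. *)
have e1 : (1 - a / alpha) * g u + a / alpha * g v +
   a * (1 / alpha * g u - 1 / alpha * g v) = g u by field.
have e2 : (1 - a / alpha) * g u + a / alpha * g v -
   (alpha - a) * (1 / alpha * g u - 1 / alpha * g v) = g v by field.
by rewrite e1 e2.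
Qed.

Lemma derive1_affine a b x : derive1 (fun t : R => a * t + b) x = a.
Proof.
rewrite derive1E; apply: derive_val.
apply: is_derive_eq.
by rewrite addr0 /GRing.scale /= mulr1.
Qed.

Lemma calE_affine a alpha b c z :
  calE a alpha (fun x => b * x + c) z = (b * z.1 + c, b * z.2).
Proof.
rewrite /calE; case: eqP => [_|/eqP a0] /=.
  by rewrite derive1_affine; congr pair; ring.
by congr pair; field.
Qed.

Lemma calE_halfplane a alpha f z : 0 <= alpha -> BLplus f ->
  halfplane R z -> halfplane R (calE a alpha f z).
Proof.
rewrite /halfplane /= => al0 Bf z0; rewrite /calE; case: eqP => [_|/eqP a0] /=.
  have [_ _ [b [B [b0 _ fbB]]]] := Bf.
  by apply: mulr_gt0 => //; have /andP[h _] := fbB (z.1 + a * z.2);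
     exact: lt_le_trans h.
have al1 : 0 < alpha by rewrite lt_def a0.
(* The imaginary part is [1 / alpha] times an increment of the increasing map [f] between two points
   at distance [alpha * y]. *)
rewrite -mulrBr mulr_gt0 ?divr_gt0// subr_gt0 BLplus_increasing//.
rewrite -subr_gt0 (_ : _ - _ = alpha * z.2); last by ring.
exact: mulr_gt0.
Qed.

Lemma continuous_comp_lin f (c : R) : continuous f ->
  continuous (fun z : R * R => f (z.1 + c * z.2)).
Proof.
move=> cf z.
apply: (@continuous_comp _ _ _ (fun z : R * R => z.1 + c * z.2)); last exact: cf.
by apply: cvgD; [exact: cvg_fst|apply: cvgMl_tmp; exact: cvg_snd].
Qed.

Lemma cvg_to_pair (T : Type) (F : set_system T) (u v : T -> R) (l m : R) :
  Filter F -> u @ F --> l -> v @ F --> m ->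
  (u t, v t) @[t --> F] --> (l, m).
Proof. by move=> FF ul vm; apply: (cvg_pair (G := nbhs _) (H := nbhs _)). Qed.

Lemma calE_continuous a alpha f : BLplus f -> continuous (calE a alpha f).
Proof.
move=> Bf z; have cf := BLplus_continuous Bf; have [_ cf' _] := Bf.
have h (g : R -> R) c : continuous g ->
    g (z.1 + c * z.2) @[z --> z] --> g (z.1 + c * z.2).
  by move=> cg; exact: continuous_comp_lin.
rewrite /continuous_at /calE; case: eqP => [_|_] /=; apply: cvg_to_pair.
- apply: cvgB; first exact: h.
  apply: cvgM; last exact: h.
  by apply: cvgMl_tmp; exact: cvg_snd.
- by apply: cvgM; [exact: cvg_snd|exact: h].
- apply: cvgD; apply: cvgMl_tmp; first exact: h.
  by rewrite -mulNr; under eq_cvg do rewrite -mulNr; exact: h.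
- apply: cvgB; apply: cvgMl_tmp; first exact: h.
  by rewrite -mulNr; under eq_cvg do rewrite -mulNr; exact: h.
Qed.

Lemma calE_homeo a alpha f : 0 <= alpha -> BLplus f ->
  homeo_onto_self (halfplane R) (calE a alpha f).
Proof.
move=> al0 Bf; have [g [Bg fK gK]] := BLplus_inverse Bf.
(* The identity is the affine map [1 * x + 0], so it extends to the identity; with functoriality
   this turns inverses into inverses. *)
have calE_id z : calE a alpha id z = z.
  rewrite (_ : id = fun x => 1 * x + 0); last by apply/funext => x; ring.
  by rewrite calE_affine; case: z => x y /=; congr pair; ring.
split; first exact/continuous_subspaceT/calE_continuous.
exists (calE a alpha g); split => [|z|z|z _|z _].
- exact/continuous_subspaceT/calE_continuous.
- exact: calE_halfplane.
- exact: calE_halfplane.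
- by rewrite -calE_comp// (_ : g \o f = id)//; exact/funext.
- by rewrite -calE_comp// (_ : f \o g = id)//; exact/funext.
Qed.

Lemma calE_cvg a alpha (f_ : nat -> R -> R) f z : BLplus_cvg f_ f ->
  calE a alpha (f_ n) z @[n --> \oo] --> calE a alpha f z.
Proof.
move=> [_ _ cf cf' _].
(* At a fixed [z] only the values of [f_ n] and its derivative at fixed points enter, so pointwise
   limits are extracted. *)
have h x : f_ n x @[n --> \oo] --> f x.
  by move/pointwise_cvg_compact_family : cf => /pointwise_cvgP; exact.
have h' x : derive1 (f_ n) x @[n --> \oo] --> derive1 f x.
  by move/pointwise_cvg_compact_family : cf' => /pointwise_cvgP; exact.
rewrite /calE; case: eqP => [_|_] /=; apply: cvg_to_pair.
- by apply: cvgB; [exact: h|apply: cvgMl_tmp; exact: h'].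
- by apply: cvgMl_tmp; exact: h'.
- by apply: cvgD; apply: cvgMl_tmp; exact: h.
- by apply: cvgB; apply: cvgMl_tmp; exact: h.
Qed.

(** * Boundary values and admissibility *)

(** The Lipschitz bound on [f] makes the distance to the boundary value linear in [y], with a
    constant independent of [x]. The witness for [C] adds up the bounds found for the two
    coordinates. *)
Lemma calE_near_boundary a alpha f : 0 <= alpha -> BLplus f ->
  exists C : R, forall x y, 0 <= y ->
    `|(calE a alpha f (x, y)).1 - f x| <= C * y /\
    `|(calE a alpha f (x, y)).2| <= C * y.
Proof.
move=> al0 Bf; have [_ _ [b [B [b0 B0 fbB]]]] := Bf.
have lip x y c : 0 <= y -> `|f (x + c * y) - f x| <= B * `|c| * y.
  move=> y0; rewrite (le_trans (deriv_between_lipschitz _ _ Bf b0 fbB))//.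
  by rewrite addrAC subrr add0r normrM (ger0_norm y0) mulrA.
have nf' x : `|derive1 f x| <= B.
  have /andP[h1 h2] := fbB x.
  by rewrite ger0_norm// (le_trans _ h1)// ltW.
rewrite /calE; case: eqP => [_|/eqP a0] /=.
  exists (B * `|a| + `|a| * B + B) => x y y0; split.
  - rewrite addrAC; apply: le_trans (ler_normB _ _) _.
    apply: (@le_trans _ _ (B * `|a| * y + `|a| * y * B)).
      rewrite lerD ?lip// !normrM (ger0_norm y0).
      by rewrite ler_wpM2l// mulr_ge0.
    by have := mulr_ge0 (ltW B0) y0; lra.
  - rewrite normrM (ger0_norm y0).
    apply: (@le_trans _ _ (y * B)); first by rewrite ler_wpM2l.
    have := mulr_ge0 (mulr_ge0 (ltW B0) (normr_ge0 a)) y0; lra.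
exists (`|1 - a / alpha| * (B * `|a|) + `|a / alpha| * (B * `|-(alpha - a)|)
  + `|1 / alpha| * (B * `|a|) + `|1 / alpha| * (B * `|-(alpha - a)|)) => x y y0.
have l1 := lip x y a y0; have l2 := lip x y (- (alpha - a)) y0.
rewrite mulNr in l2.
have pos (c d : R) : 0 <= `|c| * (B * `|d|) * y by rewrite !mulr_ge0// ltW.
split.
(* The weights [1 - a / alpha] and [a / alpha] sum to 1, so [f x] can be distributed over the two
   terms. *)
- rewrite (_ : _ - f x = (1 - a / alpha) * (f (x + a * y) - f x) +
     a / alpha * (f (x - (alpha - a) * y) - f x)); last by field.
  apply: le_trans (ler_normD _ _) _.
  rewrite (normrM (1 - a / alpha)) (normrM (a / alpha)).
  apply: le_trans (lerD (ler_wpM2l (normr_ge0 _) l1)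
    (ler_wpM2l (normr_ge0 _) l2)) _.
  have := pos (1 / alpha) a; have := pos (1 / alpha) (- (alpha - a)); lra.
(* The weights are opposite, so [f x] can be inserted in both terms. *)
- rewrite (_ : _ - _ = 1 / alpha * (f (x + a * y) - f x) -
     1 / alpha * (f (x - (alpha - a) * y) - f x)); last by field.
  apply: le_trans (ler_normB _ _) _; rewrite !(normrM (1 / alpha)).
  apply: le_trans (lerD (ler_wpM2l (normr_ge0 _) l1)
    (ler_wpM2l (normr_ge0 _) l2)) _.
  have := pos (1 - a / alpha) a; have := pos (a / alpha) (- (alpha - a)); lra.
Qed.

Lemma calE_boundary a alpha f : 0 <= alpha -> BLplus f ->
  {family compact, (fun y x : R => calE a alpha f (x, y)) @ 0^'+ -->
                   (fun x : R => (f x, 0 : R))}.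
Proof.
move=> al0 Bf; have [C hC] := calE_near_boundary a al0 Bf.
apply/fam_cvgP => A _ W /uniform_nbhs[E [entE EW]].
have [e /= e0 eE] : exists2 e : R, 0 < e &
    [set xy : (R * R) * (R * R) | ball xy.1 e xy.2] `<=` E.
  move: entE; rewrite -(@entourage_from_ballE R (R * R)%type) => -[e].
  by exists e.
have C1 : 0 < `|C| + 1 by rewrite ltr_pwDr.
near=> y; apply: EW => x _ /=; apply: eE => /=.
have y0 : 0 < y by near: y; exact: nbhs_right_gt.
have yC : C * y < e.
  (* The added 1 keeps the denominator positive even when [C] is 0. *)
  have : y < e / (`|C| + 1) by near: y; apply: nbhs_right_lt; rewrite divr_gt0.
  rewrite ltr_pdivlMr// mulrC; apply: le_lt_trans.
  rewrite ler_wpM2r ?(ltW y0)//.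
  by rewrite (le_trans (ler_norm _))// lerDl.
have [h1 h2] := hC x y (ltW y0).
split => /=; rewrite /ball /=.
- by rewrite distrC (le_lt_trans h1).
- by rewrite sub0r normrN (le_lt_trans h2).
Unshelve. all: by end_near. Qed.

Lemma calE_admissible a alpha : 0 <= alpha ->
  admissible_extension (calE a alpha).
Proof.
move=> al0; split.
- by move=> f; exact: calE_homeo.
- by move=> f; exact: calE_boundary.
- by move=> b c _ z _; exact: calE_affine.
- by move=> f g Bf Bg z _; exact: calE_comp.
- by move=> f_ f ff z _; exact: calE_cvg.
Qed.

End BiLipschitz.

(** * Measurability and integrability on the plane *)

Section PlaneMeasure.
Local Open Scope classical_set_scope.
Context {R : realType}.
Local Notation mR := (measurableTypeR R).
Local Notation leb2 := (@leb2 R).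
Implicit Types (U K : set (R * R)) (u v w g : R * R -> R).

(** Measurability refers to the product sigma-algebra, so an open set is written as the countable
    union of the boxes with rational centre and radius [1 / (n + 1)] that it contains. *)
Lemma open_measurable_plane U : open U -> measurable (U : set (mR * mR)).
Proof.
move=> oU.
pose box (i : rat * rat * nat) : set (R * R) :=
  ball (ratr i.1.1 : R) i.2.+1%:R^-1 `*` ball (ratr i.1.2 : R) i.2.+1%:R^-1.
pose F i := if `[< box i `<=` U >] then box i else set0.
rewrite (_ : U = \bigcup_i F i); last first.
  apply/seteqP; split => [z Uz|z [i _]]; last first.
    by rewrite /F; case: asboolP => // iU /iU.
  have /nbhs_ballP[e /= e0 eU] : nbhs z U by exact: open_nbhs_nbhs.
  have e20 : 0 < e / 2 by rewrite divr_gt0.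
  have [n ne] : exists n, n.+1%:R^-1 < e / 2.
    have [n _ h] := near_infty_natSinv_lt (PosNum e20).
    by exists n; apply: (h n) => /=.
  have n0 : 0 < n.+1%:R^-1 :> R by rewrite invr_gt0.
  have ratP (x d : R) : 0 < d -> exists q : rat, ball (ratr q : R) d x.
    move=> d0; have /rat_in_itvoo[q] : x - d < x + d by lra.
    by rewrite in_itv /= -ltr_distl => hq; exists q.
  have [p hp] := ratP z.1 _ n0; have [q hq] := ratP z.2 _ n0.
  (* The radius is below [e / 2], so by the triangle inequality a box containing [z] stays in the
     [e]-ball around [z]. *)
  exists (p, q, n) => //; rewrite /F; case: asboolP => [_ //|[]].
  move=> t [/= tp tq]; apply: eU; split => /=.
  - apply: (ball_splitr (z := ratr p : R)); apply: (le_ball (ltW ne)) => //.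
  - apply: (ball_splitr (z := ratr q : R)); apply: (le_ball (ltW ne)) => //.
apply: countable_bigcupT_measurable => [|i]; first exact: countableP.
rewrite /F; case: ifP => _; last exact: measurable0.
by apply: measurableX; exact: measurable_ball.
Qed.

Lemma continuous_measurable_plane g : continuous g ->
  measurable_fun setT (g : mR * mR -> R).
Proof.
move=> /continuousP cg; apply: (measurability _ (RGenOpens.measurableE R)).
move=> _ [_ [a [b ->] <-]]; rewrite setTI.
by apply: open_measurable_plane; apply: cg; exact: interval_open.
Qed.

Lemma compact_measurable_plane K : compact K -> measurable (K : set (mR * mR)).
Proof.
move=> cK; rewrite -(setCK K); apply: measurableC.
apply: open_measurable_plane; apply: closed_openC.
by apply: compact_closed cK; exact: norm_hausdorff.
Qed.

Lemma compact_in_square K : compact K ->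
  exists M : R, forall z, K z -> `|z.1| <= M /\ `|z.2| <= M.
Proof.
move=> /compact_bounded [M0 [_ hM]].
exists (M0 + 1) => z Kz.
have := hM (M0 + 1) (ltr_pwDr ltr01 (lexx _)) z Kz.
by rewrite /= prod_normE ge_max => /andP[].
Qed.

Lemma leb2_compact_lty K : compact K -> (leb2 K < +oo)%E.
Proof.
move=> cK; have [M hM] := compact_in_square cK.
have Ksub : K `<=` `[-M, M] `*` `[-M, M].
  move=> z /hM [h1 h2]; split => /=; rewrite in_itv /= -ler_norml //.
apply: (@le_lt_trans _ _ (leb2 (`[-M, M] `*` `[-M, M] : set (mR * mR)))).
  rewrite /leb2; apply: le_measure => //; rewrite inE.
  - exact: compact_measurable_plane.
  - by apply: measurableX; exact: measurable_itv.
rewrite /leb2 product_measure1E; [|exact: measurable_itv..].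
have fin : (lebesgue_measure (`[(- M)%R, M]%classic : set mR) < +oo)%E.
  have -> := lebesgue_measure_itv `[- M, M]%R.
  by case: ifP => _; rewrite /= -?EFinB ltry.
by apply: lte_mul_pinfty; rewrite ?ge0_fin_numE.
Qed.

Lemma continuous_bounded_on_compact g K : continuous g -> compact K ->
  [bounded g z | z in (K : set (mR * mR))].
Proof.
move=> cg cK; have /compact_bounded : compact (g @` K).
  apply: continuous_compact => //; exact: continuous_subspaceT.
move=> [M [Mr hM]]; exists M; split => // x Mx z Kz.
by apply: hM => //; exists z.
Qed.

Lemma continuous_integrable_compact g K : continuous g -> compact K ->
  leb2.-integrable K (EFin \o g).
Proof.
move=> cg cK; rewrite /leb2; apply: measurable_bounded_integrable.
- exact: compact_measurable_plane.
- exact: leb2_compact_lty.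
- apply: (@measurable_funS _ _ _ _ setT) => //.
  exact: continuous_measurable_plane.
- exact: continuous_bounded_on_compact.
Qed.

Lemma integrable_compact_support g K : continuous g -> compact K ->
  (forall z, ~ K z -> g z = 0) -> leb2.-integrable setT (EFin \o g).
Proof.
move=> cg cK g0; have := continuous_integrable_compact cg cK.
rewrite /leb2 integrable_mkcond; last exact: compact_measurable_plane.
congr (integrable _ _ _); apply/funext => z; rewrite patchE.
case: ifPn => // /negP zK; rewrite /= g0// => Kz; apply: zK; exact: mem_set.
Qed.

Lemma L2loc_continuous Om g : measurable (Om : set (mR * mR)) -> continuous g ->
  L2loc Om g.
Proof.
move=> mOm cg; split.
  apply: (@measurable_funS _ _ _ _ setT) => //.
  exact: continuous_measurable_plane.
move=> K cK _.
have cg2 : continuous (fun z => g z ^+ 2).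
  by move=> z; apply: cvgM; exact: cg.
have /integrableP[_] := continuous_integrable_compact cg2 cK.
apply: le_lt_trans; rewrite le_eqVlt; apply/orP; left; apply/eqP.
by apply: eq_integral => z _; rewrite /= ger0_norm// sqr_ge0.
Qed.

(** * Classical derivatives are weak derivatives *)

(** Fundamental theorem of calculus on [[-a, a]]. Taking [a = |M| + 1] makes the interval
    nondegenerate and puts its endpoints where [h] vanishes. *)
Lemma integral_derive_compact_support (h h' : R -> R) (M : R) :
  continuous h' -> (forall x : R, is_derive x 1 h (h' x)) ->
  (forall x, M < `|x| -> h x = 0 /\ h' x = 0) ->
  (\int[@lebesgue_measure R]_x (h' x)%:E = 0)%E.
Proof.
move=> ch' dh h0; pose a : R := `|M| + 1.
have a0 : 0 < a by rewrite ltr_pwDr.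
have Ma : M < a by rewrite (le_lt_trans (ler_norm _))// ltrDl.
have -> : (\int[@lebesgue_measure R]_x (h' x)%:E =
           \int[@lebesgue_measure R]_(x in `[(- a)%R, a]) (h' x)%:E)%E.
  rewrite [RHS]integral_mkcond; apply: eq_integral => x _; rewrite patchE.
  case: ifPn => // /negP xa; have [//|_ ->//] := h0 x.
  rewrite (lt_trans Ma)// ltNge; apply/negP => xa'; apply: xa.
  by apply: mem_set; rewrite /= in_itv /= -ler_norml.
have ch : continuous h.
  move=> x; apply: differentiable_continuous; apply/derivable1_diffP.
  by have [] := dh x.
rewrite (@continuous_FTC2 _ h' h).
- have [->// _] := h0 a (lt_le_trans Ma (ler_norm _)).
  have [|->// _] := h0 (- a); last by rewrite sube0.
  by rewrite normrN; exact: (lt_le_trans Ma (ler_norm _)).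
- by rewrite -subr_gt0 opprK addr_gt0.
- exact: continuous_subspaceT.
- split => [x _||]; first by have [] := dh x.
  + exact/cvg_at_right_filter/ch.
  + exact/cvg_at_left_filter/ch.
- by move=> x _; rewrite derive1E; apply: derive_val.
Qed.

(** The two difference quotients are the same function of the increment; this passes from
    directional derivatives in the plane to one variable. *)
Lemma is_derive_slice1 g (x y l : R) :
  is_derive (x, y) (1, 0) g l -> is_derive x 1 (fun t => g (t, y)) l.
Proof.
have E : (fun h : R => h^-1 *: (g (h *: (1, 0) + (x, y)) - g (x, y))) =
         (fun h : R => h^-1 *: (g (h *: 1 + x, y) - g (x, y))).
  apply/funext => h; congr (_ *: (g _ - _)).
  by congr pair; rewrite /= scaler0 add0r.
by move=> [dg <-]; split; [move: dg|]; rewrite /derivable /derive E.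
Qed.

Lemma is_derive_slice2 g (x y l : R) :
  is_derive (x, y) (0, 1) g l -> is_derive y 1 (fun t => g (x, t)) l.
Proof.
have E : (fun h : R => h^-1 *: (g (h *: (0, 1) + (x, y)) - g (x, y))) =
         (fun h : R => h^-1 *: (g (x, h *: 1 + y) - g (x, y))).
  apply/funext => h; congr (_ *: (g _ - _)).
  by congr pair; rewrite /= scaler0 add0r.
by move=> [dg <-]; split; [move: dg|]; rewrite /derivable /derive E.
Qed.

(** By Fubini the inner integral can be taken along [e], where it vanishes by the one-variable
    statement. *)
Lemma Rintegral_derive_compact_support K (e : R * R) u v :
  e = (1, 0) \/ e = (0, 1) -> compact K -> continuous v ->
  (forall z, is_derive z e u (v z)) ->
  (forall z, ~ K z -> u z = 0 /\ v z = 0) ->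
  \int[leb2]_z v z = 0.
Proof.
move=> he cK cv du uv0; have [M hM] := compact_in_square cK.
have iv : leb2.-integrable setT (EFin \o v).
  by apply: (integrable_compact_support cv cK) => z /uv0[].
rewrite /Rintegral; case: he => he; rewrite he in du.
- rewrite -(integral21_prod_meas1 iv) integral0_eq// => y _.
  apply: (@integral_derive_compact_support (fun x => u (x, y)) _ M).
  + move=> x.
    apply: (@continuous_comp _ _ _ (fun x => (x, y)) v); last exact: cv.
    by apply: cvg_to_pair; [exact: cvg_id|exact: cvg_cst].
  + by move=> x; apply: is_derive_slice1; exact: du.
  + by move=> x Mx; apply: uv0 => /hM[/=]; rewrite leNgt Mx.
- rewrite -(integral12_prod_meas1 iv) integral0_eq// => x _.
  apply: (@integral_derive_compact_support (fun y => u (x, y)) _ M).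
  + move=> y.
    apply: (@continuous_comp _ _ _ (fun y => (x, y)) v); last exact: cv.
    by apply: cvg_to_pair; [exact: cvg_cst|exact: cvg_id].
  + by move=> y; apply: is_derive_slice2; exact: du.
  + by move=> y My; apply: uv0 => /hM[/= _]; rewrite leNgt My.
Qed.

(** Integration by parts: [u * 'D_e phi + v * phi] is the derivative of [u * phi], which is
    supported in the compact set [K]. *)
Lemma weak_derivative_C1 Om (e : R * R) u v : e = (1, 0) \/ e = (0, 1) ->
  continuous u -> continuous v -> (forall z, is_derive z e u (v z)) ->
  weak_derivative Om e u v.
Proof.
move=> he cu cv du phi [sphi cK KOm]; set K := closure _ in cK KOm.
have [cphi dphi] := sphi [::]; have [cDphi _] := sphi [:: e].
rewrite /= in cphi dphi cDphi.
have phi0 z : ~ K z -> phi z = 0.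
  move=> Kz; apply/eqP; apply/negPn/negP => pz; apply: Kz.
  exact: subset_closure.
(* The complement of the support is open, so [phi] vanishes near each of its points and its
   derivative vanishes there too. *)
have Dphi0 z : ~ K z -> 'D_e phi z = 0.
  move=> Kz; rewrite (@near_eq_derive _ _ _ _ (cst 0)) ?derive_cst//.
  have : open_nbhs z (~` K).
    by split => //; apply: closed_openC; exact: closed_closure.
  by move/open_nbhs_nbhs; apply: filterS => t; exact: phi0.
have nOm z : ~ Om z -> ~ K z by move=> h /KOm.
(* Since [K] lies in [Om], integrals over [Om] become integrals over the plane, where Fubini
   applies. *)
have restr g : (forall z, ~ K z -> g z = 0) ->
    \int[leb2]_(z in Om) g z = \int[leb2]_z g z.
  move=> g0; rewrite Rintegral_mkcond; congr (Rintegral _ _ _).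
  apply/funext => z; rewrite patchE; case: ifPn => // /negP zO.
  by rewrite g0//; apply: nOm => Oz; apply: zO; exact: mem_set.
have cw1 : continuous (fun z => u z * 'D_e phi z).
  by move=> z; apply: cvgM; [exact: cu|exact: cDphi].
have cw2 : continuous (fun z => v z * phi z).
  by move=> z; apply: cvgM; [exact: cv|exact: cphi].
have w1 z : ~ K z -> u z * 'D_e phi z = 0 by move=> /Dphi0 ->; rewrite mulr0.
have w2 z : ~ K z -> v z * phi z = 0 by move=> /phi0 ->; rewrite mulr0.
rewrite !restr//; apply/eqP; rewrite -addr_eq0 -RintegralD//.
- apply/eqP; apply: (@Rintegral_derive_compact_support K e (u * phi)) => //.
  + by move=> z; apply: cvgD; [exact: cw1|exact: cw2].
  + move=> z; have h1 := du z.
    have h2 : is_derive z e phi ('D_e phi z) by exact/derivableP.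
    apply: is_derive_eq; rewrite /GRing.scale /=; ring.
  + by move=> z Kz; rewrite w1// w2// addr0; split => //;
      rewrite /= /GRing.mul /= phi0// mulr0.
- exact: integrable_compact_support cw1 cK w1.
- exact: integrable_compact_support cw2 cK w2.
Qed.

End PlaneMeasure.

(** * Sobolev regularity and dilatation of [calE] for positive [alpha] *)

Section Quasiconformality.
Local Open Scope classical_set_scope.
Context {R : realType}.
Local Notation mR := (measurableTypeR R).
Implicit Types (f : R -> R).

(** Along [e] the inner linear form moves with speed [l], so the difference quotient is that of [f]
    in the direction [l], and linearity of the differential extracts the factor [l]. *)
Lemma is_derive_ridge f (c : R) (e z : R * R) : BLplus f ->
  is_derive z e (fun z => f (z.1 + c * z.2))
    ((e.1 + c * e.2) * derive1 f (z.1 + c * z.2)).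
Proof.
move=> [df _ _]; set s := z.1 + _; set l := e.1 + _.
have diff_f : differentiable f s by exact/derivable1_diffP.
have E : (fun h : R => h^-1 *: ((fun z => f (z.1 + c * z.2)) (h *: e + z) -
                                (fun z => f (z.1 + c * z.2)) z)) =
         (fun h : R => h^-1 *: (f (h *: l + s) - f s)).
  apply/funext => h; congr (_ *: (f _ - _)).
  rewrite -[LHS]/(h * e.1 + z.1 + c * (h * e.2 + z.2)).
  by rewrite -[RHS]/(h * l + s) /l /s; ring.
have h1 : derivable f s l by exact: diff_derivable.
split; first by rewrite /derivable E.
rewrite /derive E -/(derive f s l) deriveE// derive1E'//.
by rewrite -[in LHS](mulr1 l) -[l * 1]/(l *: (1 : R)) linearZ.
Qed.

(** With [s = a] and [t = -(alpha - a)] this form covers both the real and the imaginary part of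
    [calE]. *)
Lemma W12loc_grad_ridge f (k l s t : R) : BLplus f ->
  W12loc_grad (halfplane R)
    (fun z => k * f (z.1 + s * z.2) + l * f (z.1 + t * z.2))
    (fun z => k * derive1 f (z.1 + s * z.2) + l * derive1 f (z.1 + t * z.2))
    (fun z => k * s * derive1 f (z.1 + s * z.2) +
              l * t * derive1 f (z.1 + t * z.2)).
Proof.
move=> Bf; have cf := BLplus_continuous Bf; have [_ cf' _] := Bf.
have mH : measurable (halfplane R : set (mR * mR)).
  apply: open_measurable_plane.
  rewrite (_ : halfplane R = snd @^-1` [set x | 0 < x])//.
  by apply: open_comp; [move=> z _; exact: cvg_snd|exact: open_gt].
have c2 (g : R -> R) (k1 k2 : R) : continuous g ->
    continuous (fun z : R * R =>
      k1 * g (z.1 + s * z.2) + k2 * g (z.1 + t * z.2)).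
  by move=> cg z; apply: cvgD; apply: cvgMl_tmp; exact: continuous_comp_lin.
have d2 e z : is_derive z e
    (fun z => k * f (z.1 + s * z.2) + l * f (z.1 + t * z.2))
    (k * ((e.1 + s * e.2) * derive1 f (z.1 + s * z.2)) +
     l * ((e.1 + t * e.2) * derive1 f (z.1 + t * z.2))).
  exact: (is_deriveD (is_deriveZ k (is_derive_ridge s e z Bf))
                     (is_deriveZ l (is_derive_ridge t e z Bf))).
split.
- by apply: L2loc_continuous => //; exact: c2.
- by apply: L2loc_continuous => //; exact: c2.
- by apply: L2loc_continuous => //; exact: c2.
- apply: weak_derivative_C1; [by left|exact: c2|exact: c2|] => z.
  by apply: (is_derive_eq (d2 (1, 0) z)) => /=; ring.
- apply: weak_derivative_C1; [by right|exact: c2|exact: c2|] => z.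
  by apply: (is_derive_eq (d2 (0, 1) z)) => /=; ring.
Qed.

Local Open Scope complex_scope.

Lemma dzE (ux uy vx vy : R) : dz (ux +i* vx) (uy +i* vy) =
  ((ux + vy) / 2) +i* ((vx - uy) / 2).
Proof.
rewrite /dz -(rmorph_nat (real_complex R) 2) -fmorphV /=.
by simpc; congr (_ +i* _); ring.
Qed.

Lemma dzbarE (ux uy vx vy : R) : dzbar (ux +i* vx) (uy +i* vy) =
  ((ux - vy) / 2) +i* ((vx + uy) / 2).
Proof.
rewrite /dzbar -(rmorph_nat (real_complex R) 2) -fmorphV /=.
by simpc; congr (_ +i* _); ring.
Qed.

(* |dz F|^2 - |dzbar F|^2 is the Jacobian determinant. *)
Lemma dilatation_le (ux uy vx vy m N : R) : 0 < m -> 0 <= N ->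
  m <= ux * vy - uy * vx ->
  ((ux - vy) / 2) ^+ 2 + ((vx + uy) / 2) ^+ 2 <= N ->
  cabs (dzbar (ux +i* vx) (uy +i* vy)) / cabs (dz (ux +i* vx) (uy +i* vy)) <=
  Num.sqrt (N / (m + N)).
Proof.
move=> m0 N0 mJ nN; rewrite dzE dzbarE /cabs /=.
set n := _ + _ in nN *; set d := ((ux + vy) / 2) ^+ 2 + _.
have n0 : 0 <= n by rewrite addr_ge0// sqr_ge0.
have dE : d = n + (ux * vy - uy * vx) by rewrite /d /n; field.
have d0 : 0 < d by rewrite dE; lra.
have mN0 : 0 < m + N by lra.
rewrite -sqrtrV ?(ltW d0)// -sqrtrM// ler_wsqrtr//.
rewrite ler_pdivrMr// mulrAC ler_pdivlMr// dE.
(* With denominators cleared and [J] the Jacobian, the claim is [n * m <= N * J], which follows from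
   [n <= N] and [m <= J]. *)
nra.
Qed.

Lemma calE_quasiconformal (a alpha : R) f : 0 < alpha -> BLplus f ->
  quasiconformal (calE a alpha f).
Proof.
move=> al0 Bf; split; first by apply: calE_homeo => //; exact: ltW.
have [_ _ [b [B [b0 B0 fbB]]]] := Bf.
have al1 : alpha != 0 by rewrite gt_eqF.
pose t := - (alpha - a).
pose gx k l z := k * derive1 f (z.1 + a * z.2) + l * derive1 f (z.1 + t * z.2).
pose gy k l z := k * a * derive1 f (z.1 + a * z.2) +
  l * t * derive1 f (z.1 + t * z.2).
have EF k l : (fun z => k * f (z.1 + a * z.2) + l * f (z.1 + t * z.2)) =
  (fun z : R * R => k * f (z.1 + a * z.2) + l * f (z.1 - (alpha - a) * z.2)).
  by apply/funext => z; rewrite /t mulNr.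
pose c := a / alpha.
exists (gx (1 - c) c), (gy (1 - c) c), (gx (1 / alpha) (- (1 / alpha))),
  (gy (1 / alpha) (- (1 / alpha))) => Fx Fy ratio.
have bd (k l : R) : exists M, forall p q : R, b <= p <= B -> b <= q <= B ->
    `|k * p + l * q| <= M.
  exists ((`|k| + `|l|) * B) => p q /andP[p1 p2] /andP[q1 q2].
  rewrite (le_trans (ler_normD _ _))// !normrM mulrDl.
  rewrite (ger0_norm (le_trans (ltW b0) p1)) (ger0_norm (le_trans (ltW b0) q1)).
  by rewrite lerD// ler_wpM2l.
(* These are the coefficients of the real and imaginary parts of dzbar F, as linear forms in the two
   values of [f']. *)
have [M1 hM1] := bd ((1 - c - a / alpha) / 2) ((c + t / alpha) / 2).
have [M2 hM2] :=
  bd ((1 / alpha + (1 - c) * a) / 2) ((- (1 / alpha) + c * t) / 2).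
pose N := M1 ^+ 2 + M2 ^+ 2.
have N0 : 0 <= N by rewrite addr_ge0// sqr_ge0.
have b20 : 0 < b ^+ 2 by rewrite exprn_gt0.
have jac z : b ^+ 2 <= gx (1 - c) c z * gy (1 / alpha) (- (1 / alpha)) z -
                       gy (1 - c) c z * gx (1 / alpha) (- (1 / alpha)) z.
  rewrite /gx /gy; set p := derive1 f _; set q := derive1 f _.
  (* The linear change of coordinates and its inverse have determinants that cancel, leaving the
     Jacobian of the product map [f x f]. *)
  suff <- : p * q = (((1 - c) * p + c * q) *
      (1 / alpha * a * p + - (1 / alpha) * t * q) -
    ((1 - c) * a * p + c * t * q) * (1 / alpha * p + - (1 / alpha) * q)).
  have /andP[p1 _] := fbB (z.1 + a * z.2).
  have /andP[q1 _] := fbB (z.1 + t * z.2).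
    by rewrite expr2 ler_pM// ltW.
  by rewrite /c /t; field.
have ratio_le z : ratio z <= Num.sqrt (N / (b ^+ 2 + N)).
  apply: dilatation_le => //.
  have hp := fbB (z.1 + a * z.2); have hq := fbB (z.1 + t * z.2).
  have sq (x M : R) : `|x| <= M -> x ^+ 2 <= M ^+ 2.
    move=> xM.
    by rewrite -(real_normK (num_real x)) lerXn2r ?nnegrE ?(le_trans _ xM).
  apply: lerD; apply: sq.
  - apply: le_trans (hM1 _ _ hp hq); rewrite le_eqVlt; apply/orP; left.
    by apply/eqP; congr `|_|; rewrite /gx /gy; field.
  - apply: le_trans (hM2 _ _ hp hq); rewrite le_eqVlt; apply/orP; left.
    by apply/eqP; congr `|_|; rewrite /gx /gy; field.
split.
- rewrite (_ : (fun z => _) = (fun z : R * R =>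
    (1 - c) * f (z.1 + a * z.2) + c * f (z.1 + t * z.2))).
    exact: W12loc_grad_ridge.
  by rewrite EF; apply/funext => z; rewrite /calE (negbTE al1).
- rewrite (_ : (fun z => _) = (fun z : R * R =>
    1 / alpha * f (z.1 + a * z.2) + - (1 / alpha) * f (z.1 + t * z.2))).
    exact: W12loc_grad_ridge.
  by rewrite EF; apply/funext => z; rewrite /calE (negbTE al1) mulNr.
- apply: aeW => z _; rewrite dzE; apply/eqP => -[h1 h2].
  (* If dz F vanished, then [vy = - ux] and [vx = uy], so the Jacobian would be
     [- (ux ^+ 2 + uy ^+ 2) <= 0], against its bound [b ^+ 2 > 0]. *)
  have := jac z; have := b20; move: h1 h2.
  set ux := gx _ _ z; set uy := gy _ _ z.
  set vx := gx _ _ z; set vy := gy _ _ z.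
  nra.
- apply: (@le_lt_trans _ _ (Num.sqrt (N / (b ^+ 2 + N)))%:E).
    apply/ess_supP; apply: aeW => z; rewrite patchE; case: ifP => _.
      by rewrite lee_fin.
    by rewrite lee_fin sqrtr_ge0.
  (* The bound is strictly below 1 because [b ^+ 2 > 0]. *)
  rewrite lte_fin -[X in _ < X]sqrtr1 ltr_sqrt// ltr_pdivrMr; lra.
Qed.

End Quasiconformality.

Theorem mainTheorem4 (R : realType) :
  (forall a alpha : R, 0 <= alpha -> admissible_extension (calE a alpha)) /\
  (forall (a alpha : R) (f : R -> R), 0 < alpha -> BLplus f ->
     quasiconformal (calE a alpha f)).
Proof.
split=> [a alpha|a alpha f]; first exact: calE_admissible.
exact: calE_quasiconformal.
Qed.
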